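(* Let $X$ be a real-valued random variable with distribution function $F(x)=\mathbb{P}(X\le x)$, $-\infty<x<\infty$, and let $\{X_n;\ n\ge 1\}$ be a sequence of i.i.d. random variables with common distribution function $F$. Suppose that for some $0<\rho<\infty$, $$\frac{\log\max_{1\le k\le n}X_k}{\log n}\to\frac1\rho\quad\text{in probability as } n\to\infty.$$ Then $$\lim_{n\to\infty}\frac{\ln\mathbb{P}\left(\frac{\log\max_{1\le k\le n}X_k}{\log n}\ge\frac1\rho+x\right)}{\ln n}=-\rho x\qquad\text{for all }x>0$$ and $$\lim_{n\to\infty}\frac{\log\left(-\ln\mathbb{P}\left(\frac{\log\max_{1\le k\le n}X_k}{\log n}\le\frac1\rho-y\right)\right)}{\ln n}=\rho y\qquad\text{for all }0<y<\frac1\rho.$$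
   Context: Convention: $\log x=\ln(e\vee x)=\ln\max(e,x)$ for all $-\infty<x<\infty$, where $\ln$ is the natural logarithm. *)

(* Defs.v *)
From HB Require Import structures.
From mathcomp Require Import all_boot all_order all_algebra finmap.
From mathcomp Require Import all_classical all_reals all_analysis.

Set Implicit Arguments.
Unset Strict Implicit.
Unset Printing Implicit Defensive.

Import Order.TTheory GRing.Theory Num.Theory.
Import numFieldNormedType.Exports.

Local Open Scope classical_set_scope.
Local Open Scope ring_scope.

(* log x = ln (max (e, x)); always at least 1. *)
Definition elog (R : realType) (x : R) : R := ln (Num.max (expR 1) x).

(* The same function on the extended reals, with value +oo at +oo.  It is
   needed because - ln p, for a probability p, is +oo at p = 0. *)
Definition eloge (R : realType) (x : \bar R) : \bar R :=
  lne (Order.max (expR 1)%:E x).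

Definition mutually_independent (d : measure_display) (T : measurableType d)
    (R : realType) (P : probability T R) (I : choiceType)
    (X : I -> {RV P >-> R}) : Prop :=
  forall (J : {fset I}) (A : I -> set R),
    (forall j, measurable (A j)) ->
    P (\bigcap_(j in [set` J]) (X j @^-1` A j)) =
    (\prod_(j <- J) P (X j @^-1` A j))%E.

Definition identically_distributed (d : measure_display)
    (T : measurableType d) (R : realType) (P : probability T R) (I : Type)
    (X : I -> {RV P >-> R}) (F : R -> \bar R) : Prop :=
  forall i, cdf (X i) = F.

Definition cvg_in_probability (d : measure_display) (T : measurableType d)
    (R : realType) (P : probability T R) (Y : nat -> T -> R) (l : R) : Prop :=
  forall eps : R, 0 < eps ->
    P [set w | eps < `|Y n w - l|] @[n --> \oo] --> 0%E.

(* Sequences are indexed from 0, so that X k stands for X_(k+1) and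
   runmax X n is the maximum of the first n terms X_1, ..., X_n; the default
   X 0 of the iterated maximum is one of these terms as soon as 0 < n. *)
Definition runmax (T : Type) (R : realType) (X : nat -> T -> R) (n : nat)
    (w : T) : R :=
  \big[Num.max/X 0%N w]_(k < n) X k w.

Definition log_max_ratio (T : Type) (R : realType) (X : nat -> T -> R)
    (n : nat) (w : T) : R :=
  elog (runmax X n w) / elog n%:R.

(* Main.v *)
(* Write M_n for the maximum of the first n terms and S(s) = P(X > e^s), so that
   P(M_n <= n^a) = (1 - S(a ln n))^n.  Convergence in probability forces this to
   be at most 1/2 eventually when a < 1/rho and at least 1/2 when a > 1/rho; by
   the two Bernoulli-type bounds 1 - n s <= (1 - s)^n <= 1 / (1 + n s), n S(b ln n)
   is then bounded below for b < 1/rho and above for b > 1/rho.  Interpolating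
   between integers with the monotonicity of S, e^(-cs) <= S(s) for c > rho and
   S(s) <= e^(-cs) for c < rho, for all large s.  Hence n S(a ln n) is
   n^(1 - rho a + o(1)), which is the order of P(M_n > n^a) if a > 1/rho and of
   - ln P(M_n <= n^a) if 0 < a < 1/rho. *)
Require Import Defs.
From HB Require Import structures.
From mathcomp Require Import all_boot all_order all_algebra.
From mathcomp Require Import all_classical all_reals all_analysis.
From mathcomp Require Import measurable_realfun ring lra.

Import Order.TTheory GRing.Theory Num.Theory.
Import numFieldNormedType.Exports.

Local Open Scope classical_set_scope.
Local Open Scope ring_scope.

(** * Bernoulli-type inequalities and logarithmic limits *)

Lemma bernoulli_le (R : realDomainType) (s : R) (n : nat) :
  s <= 1 -> 1 - n%:R * s <= (1 - s) ^+ n.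
Proof.
move=> s1; elim: n => [|n ih]; first by rewrite mul0r subr0 expr0.
rewrite exprS -[n.+1%:R]natr1.
apply: le_trans (ler_wpM2l _ ih); last by rewrite subr_ge0.
have : 0 <= n%:R * s ^+ 2 by rewrite mulr_ge0 ?ler0n ?sqr_ge0.
by lra.
Qed.

(** By induction: the step needs only (1 - s) (1 + (n+1) s) = 1 + n s - (n+1) s^2 <= 1 + n s. *)
Lemma expr_1subr_le (R : realFieldType) (s : R) (n : nat) :
  0 <= s <= 1 -> (1 - s) ^+ n <= (1 + n%:R * s)^-1.
Proof.
move=> /andP[s0 s1].
have h k : 0 < 1 + k%:R * s by rewrite ltr_wpDr// mulr_ge0.
elim: n => [|n ih]; first by rewrite mul0r addr0 invr1.
rewrite exprS; apply: le_trans (ler_wpM2l _ ih) _; first by rewrite subr_ge0.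
rewrite ler_pdivrMr// mulrC ler_pdivlMr// -natr1.
have : 0 <= n%:R * s ^+ 2 by rewrite mulr_ge0 ?ler0n ?sqr_ge0.
have := sqr_ge0 s.
by lra.
Qed.

Lemma cvg_ln_pinfty (R : realType) : ln (n%:R : R) @[n --> \oo] --> +oo.
Proof.
apply/cvgryPge => A; near=> n.
have n0 : 0 < n%:R :> R.
  by rewrite (lt_le_trans (expR_gt0 A))//; near: n; exact: nbhs_infty_ger.
rewrite -ler_expR lnK ?posrE//.
by near: n; exact: nbhs_infty_ger.
Unshelve. all: by end_near. Qed.

Lemma near_scale_pinfty (R : realType) (Q : R -> Prop) (a : R) : 0 < a ->
  (\forall s \near +oo, Q s) -> \forall s \near +oo, Q (a * s).
Proof.
move=> a0 [M [_ MQ]]; exists (M / a); split; first exact: num_real.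
by move=> s; rewrite ltr_pdivrMr// mulrC => /MQ.
Qed.

(* The slack between [l] and the exponents [u] absorbs the constant [K]. *)
Lemma ln_div_ln_cvg (R : realType) (f : nat -> R) (l K : R) : 0 < K ->
  (forall u, l < u -> \forall n \near \oo, f n <= K * expR (u * ln n%:R)) ->
  (forall u, u < l -> \forall n \near \oo, expR (u * ln n%:R) <= K * f n) ->
  ln (f n) / ln n%:R @[n --> \oo] --> l.
Proof.
move=> K0 fub flb; apply/cvgrPdist_le => e e0.
have e20 : 0 < e / 2 by rewrite divr_gt0.
have lub : l < l + e / 2 by rewrite ltrDl.
have llb : l - e / 2 < l by rewrite ltrBlDr ltrDl.
near=> n.
have L0 : 0 < ln (n%:R : R).
  by near: n; exact: cvgry_gt (cvg_ln_pinfty R) _.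
have LK : `|ln K| / (e / 2) <= ln (n%:R : R).
  by near: n; exact: cvgry_ge (cvg_ln_pinfty R) _.
move: LK; rewrite ler_pdivrMr// ler_norml => /andP[LK1 LK2].
have fu : f n <= K * expR ((l + e / 2) * ln n%:R) by near: n; exact: fub.
have fl : expR ((l - e / 2) * ln n%:R) <= K * f n by near: n; exact: flb.
have f0 : 0 < f n.
  by rewrite -(pmulr_rgt0 _ K0) (lt_le_trans _ fl)// expR_gt0.
move: fu; rewrite -ler_ln ?posrE ?mulr_gt0 ?expR_gt0// lnM ?posrE ?expR_gt0//.
rewrite expRK => fu.
move: fl; rewrite -ler_ln ?posrE ?mulr_gt0 ?expR_gt0// lnM ?posrE//.
rewrite expRK => fl.
rewrite ler_distlC ler_pdivlMr// ler_pdivrMr//.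
by apply/andP; split; lra.
Unshelve. all: by end_near. Qed.

(** * Exponential tail bounds, interpolated from the points b ln n *)

Section tail.
Context {R : realType} (S : R -> R).
Hypothesis S_noninc : {homo S : s t / s <= t >-> t <= s}.

(** With x = e^(s/b) and n the integer part of x, s <= b ln (n+1), so monotonicity gives S(s) >= 1 /
    (2 (n+1)), of order e^(-s/b). The gap between 1/b and c absorbs the constants. *)
Lemma expR_le_tail (b c : R) : 0 < b -> b^-1 < c ->
  (\forall n \near \oo, 1 <= 2 * (n%:R * S (b * ln n%:R))) ->
  \forall s \near +oo, expR (- (c * s)) <= S s.
Proof.
move=> b0 bc [N _ NS]; near=> s.
have s0 : 0 <= s by [].
have sb0 : 0 <= b^-1 * s by rewrite mulr_ge0// invr_ge0 ltW.
set x := expR (b^-1 * s).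
have x1 : 1 <= x by rewrite -expR0 ler_expR.
have /andP[nx xn] := truncn_itv (ltW (expR_gt0 (b^-1 * s))).
set n := Num.trunc _ in nx xn.
have n0 : 0 < n.+1%:R :> R by [].
have sn : s <= b * ln n.+1%:R.
  by rewrite mulrC -ler_pdivrMr// mulrC -ler_expR lnK ?posrE// ltW.
have /NS Sn : (N <= n.+1)%N.
  rewrite -(ler_nat R) (le_trans _ (ltW xn))// (le_trans _ (expR_ge1Dx _))//.
  by rewrite ler_wpDl// mulrC ler_pdivlMr.
(* The 4 is 2 from the hypothesis times 2 from n + 1 <= 2 x, valid because x >= 1. *)
have {}Sn : 1 <= 4 * (x * S s).
  apply: (le_trans Sn); have Sle := S_noninc _ _ sn.
  have S0 : 0 <= S s.
    apply: le_trans Sle; rewrite -(pmulr_rge0 _ n0) -(@pmulr_rge0 _ 2)//.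
    by rewrite (le_trans _ Sn).
  have -> : 4 * (x * S s) = 2 * ((2 * x) * S s) by ring.
  rewrite ler_wpM2l// (le_trans (ler_wpM2l _ Sle))// ler_wpM2r//.
  by rewrite -natr1; rewrite -/x in nx; lra.
have : 4 * x <= expR (c * s).
  have -> : c * s = (c - b^-1) * s + b^-1 * s by ring.
  rewrite expRD ler_wpM2r ?expR_ge0// (le_trans _ (expR_ge1Dx _))//.
  have : 3 <= (c - b^-1) * s.
    by rewrite mulrC -ler_pdivrMr ?subr_gt0.
  by lra.
move=> xc; rewrite expRN -[leLHS]mul1r ler_pdivrMr ?expR_gt0//.
have S0 : 0 <= S s.
  by rewrite -(@pmulr_rge0 _ (4 * x)) ?mulr_gt0 ?expR_gt0// -mulrA (le_trans _ Sn).
by apply: (le_trans Sn); rewrite mulrA mulrC ler_wpM2l.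
Unshelve. all: by end_near. Qed.

(** Here the integer is rounded down: n <= e^(s/b) puts b ln n below s, so S(s) <= 1/n, and n is at
    least half of e^(s/b). *)
Lemma tail_le_expR (b c : R) : 0 < b -> c < b^-1 ->
  (\forall n \near \oo, n%:R * S (b * ln n%:R) <= 1) ->
  \forall s \near +oo, S s <= expR (- (c * s)).
Proof.
move=> b0 bc [N _ NS]; near=> s.
have s0 : 0 <= s by [].
have sb0 : 0 <= b^-1 * s by rewrite mulr_ge0// invr_ge0 ltW.
set x := expR (b^-1 * s).
have x1 : 1 <= x by rewrite -expR0 ler_expR.
have /andP[nx xn] := truncn_itv (ltW (expR_gt0 (b^-1 * s))).
set n := Num.trunc _ in nx xn; rewrite -/x in nx xn.
have n1 : (0 < n)%N by rewrite -ltnS -(ltr_nat R) (le_lt_trans x1).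
have n0 : 0 < n%:R :> R by rewrite ltr0n.
have sn : b * ln n%:R <= s.
  by rewrite mulrC -ler_pdivlMr// [leRHS]mulrC -ler_expR lnK ?posrE.
have /NS Sn : (N <= n)%N.
  rewrite -ltnS -(ltr_nat R) (le_lt_trans _ xn)// (le_trans _ (expR_ge1Dx _))//.
  by rewrite ler_wpDl// mulrC ler_pdivlMr.
have Sle := S_noninc _ _ sn.
have {}Sn : n%:R * S s <= 1.
  by apply: le_trans Sn; rewrite ler_wpM2l.
have xn2 : x <= 2 * n%:R.
  have : 1 <= n%:R :> R by rewrite ler1n.
  by move: xn; rewrite -natr1; lra.
have cx : 2 * expR (c * s) <= x.
  have -> : x = expR ((b^-1 - c) * s) * expR (c * s).
    by rewrite -expRD; congr expR; ring.
  rewrite ler_wpM2r ?expR_ge0// (le_trans _ (expR_ge1Dx _))//.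
  have : 1 <= (b^-1 - c) * s.
    by rewrite mulrC -ler_pdivrMr ?subr_gt0.
  by lra.
rewrite expRN -[leRHS]mul1r ler_pdivlMr ?expR_gt0//.
have [S0|S0] := leP (S s) 0.
  by rewrite (le_trans _ ler01)// mulr_le0_ge0 ?expR_ge0.
apply: le_trans Sn; rewrite mulrC ler_wpM2r ?(ltW S0)//.
by rewrite -(@ler_pM2l _ 2)// (le_trans cx).
Unshelve. all: by end_near. Qed.

End tail.

(** * From the law of the maximum to the tail exponent, and back *)

Lemma natr_expRM (R : realType) (n : nat) (x : R) : 0 < n%:R :> R ->
  expR (ln n%:R + x) = n%:R * expR x.
Proof. by move=> n0; rewrite expRD lnK. Qed.

(* [S s] stands for the tail P(X > e^s), so that [(1 - S (a * ln n)) ^+ n] is the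
   probability that the maximum of the first [n] terms is at most n^a. *)
Section max_of_tail.
Context {R : realType} {S : R -> R} {rho : R}.
Hypothesis S_noninc : {homo S : s t / s <= t >-> t <= s}.
Hypothesis S_prob : forall s, 0 <= S s <= 1.
Hypothesis rho_gt0 : 0 < rho.
Hypothesis max_large : forall b, 0 < b -> b < rho^-1 ->
  \forall n \near \oo, (1 - S (b * ln n%:R)) ^+ n <= 2^-1.
Hypothesis max_small : forall b, rho^-1 < b ->
  \forall n \near \oo, 2^-1 <= (1 - S (b * ln n%:R)) ^+ n.

Lemma tail_ge_expR_rho (c : R) : rho < c ->
  \forall s \near +oo, expR (- (c * s)) <= S s.
Proof.
(* The reciprocal of the midpoint of [rho] and [c], so that both b < 1/rho and 1/b < c. *)
move=> rc; pose b := 2 / (rho + c).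
have rc0 : 0 < rho + c by rewrite addr_gt0// (lt_trans rho_gt0).
have b0 : 0 < b by rewrite divr_gt0.
have br : b < rho^-1 by rewrite ltr_pdivrMr// mulrC ltr_pdivlMr//; lra.
have bc : b^-1 < c by rewrite invf_div ltr_pdivrMr//; lra.
apply: (@expR_le_tail _ _ S_noninc b) => //.
apply: filterS (max_large _ b0 br) => n.
have /andP[_ S1] := S_prob (b * ln n%:R).
by have := bernoulli_le _ _ n S1; lra.
Qed.

Lemma tail_le_expR_rho (c : R) : c < rho ->
  \forall s \near +oo, S s <= expR (- (c * s)).
Proof.
(* For c <= 0 the bound is at least 1. For c > 0 the midpoint of [c] and [rho] is positive and its
   reciprocal serves as [b]. *)
move=> cr; have [c0|c0] := leP c 0.
  near=> s; have /andP[_ S1] := S_prob s.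
  rewrite (le_trans S1)// -expR0 ler_expR oppr_ge0 mulr_le0_ge0//.
pose b := 2 / (rho + c).
have rc0 : 0 < rho + c by rewrite addr_gt0.
have b0 : 0 < b by rewrite divr_gt0.
have br : rho^-1 < b by rewrite ltr_pdivlMr// mulrC ltr_pdivrMr//; lra.
have bc : c < b^-1 by rewrite invf_div ltr_pdivlMr//; lra.
apply: (@tail_le_expR _ _ S_noninc b) => //.
apply: filterS (max_small _ br) => n h.
have S01 := S_prob (b * ln n%:R); have /andP[S0 S1] := S01.
have := le_trans h (expr_1subr_le _ _ n S01).
rewrite lef_pV2 ?posrE ?ltr_wpDr ?mulr_ge0//; lra.
Unshelve. all: by end_near. Qed.

(** Take the tail bound of exponent c = (1 - u) / a at s = a ln n: then n e^(-cs) = n^u, and the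
    condition on [u] says exactly c > rho. *)
Lemma natr_tail_ge (a u : R) : 0 < a -> u < 1 - rho * a ->
  \forall n \near \oo, expR (u * ln n%:R) <= n%:R * S (a * ln n%:R).
Proof.
move=> a0 ua; have rc : rho < (1 - u) / a by rewrite ltr_pdivlMr//; lra.
have hs := near_scale_pinfty _ _ _ a0 (tail_ge_expR_rho _ rc).
near=> n.
have n0 : 0 < n%:R :> R.
  by rewrite ltr0n; near: n; exact: nbhs_infty_gt.
have : expR (- ((1 - u) / a * (a * ln n%:R))) <= S (a * ln n%:R).
  by near: n; exact: (cvg_ln_pinfty R _ hs).
rewrite -(ler_pM2l n0); apply: le_trans.
rewrite -(natr_expRM _ _ _ n0) ler_expR.
by rewrite mulrA divfK ?gt_eqF//; lra.
Unshelve. all: by end_near. Qed.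

Lemma natr_tail_le (a u : R) : 0 < a -> 1 - rho * a < u ->
  \forall n \near \oo, n%:R * S (a * ln n%:R) <= expR (u * ln n%:R).
Proof.
move=> a0 ua; have rc : (1 - u) / a < rho by rewrite ltr_pdivrMr//; lra.
have hs := near_scale_pinfty _ _ _ a0 (tail_le_expR_rho _ rc).
near=> n.
have n0 : 0 < n%:R :> R.
  by rewrite ltr0n; near: n; exact: nbhs_infty_gt.
have : S (a * ln n%:R) <= expR (- ((1 - u) / a * (a * ln n%:R))).
  by near: n; exact: (cvg_ln_pinfty R _ hs).
rewrite -(ler_pM2l n0) => /le_trans; apply.
rewrite -(natr_expRM _ _ _ n0) ler_expR.
by rewrite mulrA divfK ?gt_eqF//; lra.
Unshelve. all: by end_near. Qed.

Lemma max_gt_ge (a u : R) : rho^-1 < a -> u < 1 - rho * a ->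
  \forall n \near \oo,
    expR (u * ln n%:R) <= 2 * (1 - (1 - S (a * ln n%:R)) ^+ n).
Proof.
move=> ra ua; have a0 : 0 < a by rewrite (lt_trans _ ra)// invr_gt0.
have ra1 : 1 - rho * a < 0 by rewrite subr_lt0 -ltr_pdivrMl// mulr1.
near=> n.
have S01 := S_prob (a * ln n%:R); have /andP[S0 S1] := S01.
(* Since 1 - rho a < 0, the exponent 0 is admissible, whence t = n S(a ln n) <= 1. *)
have : n%:R * S (a * ln n%:R) <= expR (0 * ln n%:R).
  by near: n; exact: natr_tail_le.
have : expR (u * ln n%:R) <= n%:R * S (a * ln n%:R).
  by near: n; exact: natr_tail_ge.
rewrite mul0r expR0; have nS0 : 0 <= n%:R * S (a * ln n%:R) by rewrite mulr_ge0.
have := expr_1subr_le _ _ n S01.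
set t := n%:R * _ in nS0 *; set p := _ ^+ n => pt ut t1.
apply: (le_trans ut).
(* Holds on [0, 1] because (1 + t) (1 - t/2) = 1 + t (1 - t) / 2; this is the source of the factor
   2. *)
have : (1 + t)^-1 <= 1 - t / 2.
  by rewrite -[leLHS]mul1r ler_pdivrMr ?ltr_wpDr//; nra.
by lra.
Unshelve. all: by end_near. Qed.

Lemma max_gt_le (a u : R) : 0 < a -> 1 - rho * a < u ->
  \forall n \near \oo,
    1 - (1 - S (a * ln n%:R)) ^+ n <= expR (u * ln n%:R).
Proof.
move=> a0 ua; apply: filterS (natr_tail_le _ _ a0 ua) => n.
have /andP[_ S1] := S_prob (a * ln n%:R).
by have := bernoulli_le _ _ n S1; lra.
Qed.

(* Only [a' < a] is allowed in the upper bound: [f n] will be the probability of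
   a non-strict inequality, which involves the left limit of the cdf. *)
Lemma ln_max_gt_cvg (f : nat -> R) (a : R) : rho^-1 < a ->
  (forall a', 0 < a' -> a' < a ->
    \forall n \near \oo, f n <= 1 - (1 - S (a' * ln n%:R)) ^+ n) ->
  (\forall n \near \oo, 1 - (1 - S (a * ln n%:R)) ^+ n <= f n) ->
  ln (f n) / ln n%:R @[n --> \oo] --> 1 - rho * a.
Proof.
move=> ra fub flb; have a0 : 0 < a by rewrite (lt_trans _ ra)// invr_gt0.
apply: (@ln_div_ln_cvg _ _ _ 2) => // u ua.
  (* The value (1 - u) / rho solves 1 - rho m = u. The midpoint of [m] and [a] serves as a': it is
     positive, below [a], and satisfies 1 - rho a' < u. *)
  pose m := Num.max 0 ((1 - u) / rho).
  have ma : m < a by rewrite gt_max a0 ltr_pdivrMr//=; lra.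
  have [m0 mu] : 0 <= m /\ (1 - u) / rho <= m.
    by split; rewrite le_max lexx ?orbT.
  have mu' : 1 - u <= m * rho by rewrite -ler_pdivrMr.
  have a'0 : 0 < (m + a) / 2 by lra.
  have a'a : (m + a) / 2 < a by lra.
  near=> n.
  have : f n <= 1 - (1 - S ((m + a) / 2 * ln n%:R)) ^+ n.
    by near: n; exact: fub.
  move=> /le_trans; apply.
  apply: (@le_trans _ _ (expR (u * ln n%:R))).
    near: n; apply: max_gt_le => //.
    have : rho * m < rho * a by rewrite ltr_pM2l.
    by lra.
  by rewrite ler_peMl ?expR_ge0 ?ler1n.
near=> n.
apply: (@le_trans _ _ (2 * (1 - (1 - S (a * ln n%:R)) ^+ n))).
  by near: n; exact: max_gt_ge.
by rewrite ler_pM2l//; near: n.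
Unshelve. all: by end_near. Qed.

(** Keeps 1 - S away from 0, so that its logarithm is comparable to S. *)
Lemma near_tail_le_half (a : R) : 0 < a ->
  \forall n \near \oo, S (a * ln n%:R) <= 2^-1.
Proof.
move=> a0.
have h : \forall s \near +oo, S s <= 2^-1.
  have r2 : rho / 2 < rho by rewrite gtr_pMr ?invf_lt1 ?ltr1n.
  near=> s; apply: (@le_trans _ _ (expR (- (rho / 2 * s)))).
    by near: s; exact: tail_le_expR_rho.
  rewrite expRN lef_pV2 ?posrE ?expR_gt0// (le_trans _ (expR_ge1Dx _))//.
  have : 2 / rho <= s by near: s; exact: nbhs_pinfty_ge (num_real _).
  by rewrite ler_pdivrMr//; lra.
exact: (cvg_ln_pinfty R _ (near_scale_pinfty _ _ _ a0 h)).
Unshelve. all: by end_near. Qed.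

Lemma near_max_le_gt0 (a : R) : 0 < a ->
  \forall n \near \oo, 0 < (1 - S (a * ln n%:R)) ^+ n.
Proof.
move=> /near_tail_le_half; apply: filterS => n Sn.
by rewrite exprn_gt0//; lra.
Qed.

Lemma near_ln_max_le (a : R) : 0 < a -> \forall n \near \oo,
  n%:R * S (a * ln n%:R) <= - ln ((1 - S (a * ln n%:R)) ^+ n) <=
    2 * (n%:R * S (a * ln n%:R)).
Proof.
move=> a0; near=> n.
have /andP[S0 S1] := S_prob (a * ln n%:R).
have : S (a * ln n%:R) <= 2^-1.
  by near: n; exact: near_tail_le_half.
set s := S _ in S0 S1 * => s2 /=.
have s1 : 0 < 1 - s by lra.
rewrite lnXn// -mulNrn -[- ln _ *+ n]mulr_natl (mulrCA 2).
apply/andP; split; rewrite ler_wpM2l//.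
  rewrite lerNr; apply: le_ln1Dx; lra.
rewrite -lnV ?posrE//.
(* From ln (1 + v) <= v, - ln (1 - s) <= s / (1 - s), which is at most 2 s as s <= 1/2. *)
have -> : (1 - s)^-1 = 1 + s / (1 - s) by field; rewrite gt_eqF.
apply: le_trans (le_ln1Dx _) _.
  by rewrite (@lt_le_trans _ _ 0)// divr_ge0// ltW.
by rewrite ler_pdivrMr//; nra.
Unshelve. all: by end_near. Qed.

Lemma ln_ln_max_le_cvg (a : R) : 0 < a -> a < rho^-1 ->
  ln (- ln ((1 - S (a * ln n%:R)) ^+ n)) / ln n%:R @[n --> \oo]
    --> 1 - rho * a.
Proof.
move=> a0 ar; apply: (@ln_div_ln_cvg _ _ _ 2) => // u ua; near=> n.
  have : n%:R * S (a * ln n%:R) <= expR (u * ln n%:R).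
    by near: n; exact: natr_tail_le.
  have /andP[_] : n%:R * S (a * ln n%:R) <= - ln ((1 - S (a * ln n%:R)) ^+ n)
    <= 2 * (n%:R * S (a * ln n%:R)).
    by near: n; exact: near_ln_max_le.
  by lra.
have : expR (u * ln n%:R) <= n%:R * S (a * ln n%:R).
  by near: n; exact: natr_tail_ge.
have /andP[+ _] : n%:R * S (a * ln n%:R) <= - ln ((1 - S (a * ln n%:R)) ^+ n)
    <= 2 * (n%:R * S (a * ln n%:R)).
  by near: n; exact: near_ln_max_le.
have := expR_ge0 (u * ln n%:R); lra.
Unshelve. all: by end_near. Qed.

(** Makes the truncation at e in the outer logarithm eventually inactive; the divergence comes from
    the positive exponent 1 - rho a. *)
Lemma ln_max_le_cvg_pinfty (a : R) : 0 < a -> a < rho^-1 ->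
  - ln ((1 - S (a * ln n%:R)) ^+ n) @[n --> \oo] --> +oo.
Proof.
move=> a0 ar; pose u := (1 - rho * a) / 2.
have ra1 : 0 < 1 - rho * a by rewrite subr_gt0 -ltr_pdivlMl// mulr1.
have u0 : 0 < u by rewrite divr_gt0.
have ua : u < 1 - rho * a by rewrite /u; lra.
apply/cvgryPge => A; near=> n.
have : expR (u * ln n%:R) <= n%:R * S (a * ln n%:R).
  by near: n; exact: natr_tail_ge.
have /andP[+ _] : n%:R * S (a * ln n%:R) <= - ln ((1 - S (a * ln n%:R)) ^+ n)
    <= 2 * (n%:R * S (a * ln n%:R)).
  by near: n; exact: near_ln_max_le.
move=> /(le_trans _) h /h; apply: le_trans.
rewrite (le_trans _ (expR_ge1Dx _))// ler_wpDl// mulrC -ler_pdivrMr//.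
by near: n; exact: cvgry_ge (cvg_ln_pinfty R) _.
Unshelve. all: by end_near. Qed.

End max_of_tail.

(** * The law of the log-max ratio in terms of the distribution function *)

Lemma elog_le (R : realType) (x t : R) : 1 <= t -> (elog x <= t) = (x <= expR t).
Proof.
move=> t1; rewrite /elog -ler_expR lnK; last first.
  by rewrite posrE lt_max expR_gt0.
by rewrite ge_max ler_expR t1.
Qed.

Lemma elog_natr (R : realType) (n : nat) :
  expR 1 <= n%:R :> R -> elog (n%:R : R) = ln n%:R.
Proof. by move=> en; rewrite /elog max_r. Qed.

Lemma runmax_leP (T : Type) (R : realType) (X : nat -> T -> R) (n : nat) (w : T)
    (t : R) : (0 < n)%N ->
  runmax X n w <= t <-> (forall k, (k < n)%N -> X k w <= t).
Proof.
move=> n0; split=> [/bigmax_leP[_ h] k kn|h]; first exact: (h (Ordinal kn)).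
by apply/bigmax_leP; split=> [|i _]; exact: h.
Qed.

(** The two bounds disable the two truncations: e <= n in the denominator, 1 <= a ln n in the
    numerator. *)
Lemma log_max_ratio_le (T : Type) (R : realType) (X : nat -> T -> R) (n : nat)
    (a : R) : expR 1 <= n%:R :> R -> 1 <= a * ln n%:R ->
  [set w | log_max_ratio X n w <= a] =
  \bigcap_(k < n) X k @^-1` `]-oo, expR (a * ln n%:R)].
Proof.
move=> en an.
have L0 : 0 < ln (n%:R : R).
  by rewrite ln_gt0// (lt_le_trans _ en)// -expR0 ltr_expR.
have n0 : (0 < n)%N by rewrite -(ltr0n R) (lt_le_trans (expR_gt0 1)).
apply/seteqP; split=> w /=.
- rewrite /log_max_ratio elog_natr// ler_pdivrMr// elog_le//.
  by move=> /(runmax_leP _ _ _ _ _ _ n0) h k /= kn; rewrite in_itv/= h.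
- move=> h; rewrite /log_max_ratio elog_natr// ler_pdivrMr// elog_le//.
  apply/(runmax_leP _ _ _ _ _ _ n0) => k kn.
  by have := h k kn; rewrite /= in_itv.
Qed.

Lemma measurable_log_max_ratio (d : measure_display) (T : measurableType d)
    (R : realType) (P : probability T R) (X : nat -> {RV P >-> R}) (n : nat) :
  measurable_fun setT (log_max_ratio X n).
Proof.
apply: measurable_funM; last exact: measurable_cst.
apply: (measurableT_comp (@measurable_ln R)).
apply: measurable_maxr; first exact: measurable_cst.
(* Induction over an arbitrary list of indices, with the default [X 0] as base case. *)
rewrite /runmax; elim: (index_enum _) => [|k s ih].
  rewrite (_ : (fun w => _) = X 0%N)//.
  by apply/funext => w; rewrite big_nil.
rewrite (_ : (fun w => _) = X k \max fun w => \big[Num.max/X 0%N w]_(k <- s) X k w).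
  exact: measurable_maxr.
by apply/funext => w; rewrite big_cons.
Qed.

Lemma probability_log_max_ratio_le (d : measure_display) (T : measurableType d)
    (R : realType) (P : probability T R) (X : nat -> {RV P >-> R})
    (F : R -> \bar R) (n : nat) (a : R) :
  mutually_independent X -> identically_distributed X F ->
  expR 1 <= n%:R :> R -> 1 <= a * ln n%:R ->
  P [set w | log_max_ratio X n w <= a] = (F (expR (a * ln n%:R)) ^+ n)%E.
Proof.
move=> iX dX en an; rewrite log_max_ratio_le//.
have fn : finite_set `I_n by exact: finite_II.
(* Independence is stated for finite sets of indices, so [I_n] is first seen as one. *)
rewrite -[X in bigcap X _](fset_setK fn) iX; last by [].
under eq_bigr => k _.
  rewrite [P _](_ : _ = F (expR (a * ln n%:R))); last by rewrite -(dX k).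
  over.
rewrite big_const_seq count_predT (@card_fset_set _ _ n)//.
by move: (F _) => q; elim: n {an en fn} => // n ih; rewrite expeS -ih.
Qed.

Lemma near_probability_log_max_ratio_le (d : measure_display)
    (T : measurableType d) (R : realType) (P : probability T R)
    (X : nat -> {RV P >-> R}) (F : R -> \bar R) (a : R) :
  mutually_independent X -> identically_distributed X F -> 0 < a ->
  \forall n \near \oo, P [set w | log_max_ratio X n w <= a] =
    (fine (F (expR (a * ln n%:R))) ^+ n)%:E.
Proof.
move=> iX dX a0; near=> n.
rewrite (probability_log_max_ratio_le _ _ _ _ _ _ _ _ iX dX); first last.
- rewrite mulrC -ler_pdivrMr//.
  by near: n; exact: cvgry_ge (cvg_ln_pinfty R) _.
- by near: n; exact: nbhs_infty_ger.
by rewrite EFin_expe fineK// -(dX 0%N) fin_num_measure.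
Unshelve. all: by end_near. Qed.

Lemma fine_le_probability (d : measure_display) (T : measurableType d)
    (R : realType) (P : probability T R) (A B : set T) :
  measurable A -> measurable B -> A `<=` B -> fine (P A) <= fine (P B).
Proof.
move=> mA mB AB; rewrite fine_le ?fin_num_measure//.
by rewrite le_measure ?inE.
Qed.

Lemma lne_div_ln (R : realType) (p : R) (n : nat) : 0 < p -> (1 < n)%N ->
  (lne p%:E / (ln (n%:R : R))%:E)%E = (ln p / ln n%:R)%:E.
Proof.
move=> p0 n1; rewrite lne_EFin// inver gt_eqF// ln_gt0//.
by rewrite ltr1n.
Qed.

Lemma near_EFin_cvg (R : realType) (f : nat -> \bar R) (g : nat -> R) (l : R) :
  (\forall n \near \oo, f n = (g n)%:E) ->
  g n @[n --> \oo] --> l -> f n @[n --> \oo] --> l%:E.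
Proof.
move=> fg gl; apply/fine_cvgP; split; first by apply: filterS fg => n ->.
apply: cvg_trans gl; apply: near_eq_cvg.
by apply: filterS fg => n /= ->.
Qed.

(** * Deviations of the ratio above and below [rho^-1] *)

Theorem theorem2p4 (R : realType) (d : measure_display) (T : measurableType d)
    (P : probability T R) (X : {RV P >-> R}) (F : R -> \bar R)
    (X_ : nat -> {RV P >-> R}) (rho : R)
    (hF : cdf X = F)
    (hindep : mutually_independent X_)
    (hident : identically_distributed X_ F)
    (hrho : 0 < rho)
    (hcvg : cvg_in_probability P (log_max_ratio X_) rho^-1) :
  (forall x : R, 0 < x ->
     (lne (P [set w | rho^-1 + x <= log_max_ratio X_ n w]%R)
        / (ln (n%:R : R))%:E)%E @[n --> \oo] --> (- (rho * x))%:E) /\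
  (forall y : R, 0 < y -> y < rho^-1 ->
     (eloge (- lne (P [set w | log_max_ratio X_ n w <= rho^-1 - y]%R))
        / (ln (n%:R : R))%:E)%E @[n --> \oo] --> (rho * y)%:E).
Proof.
(* The tail P(X > e^s) on the logarithmic scale. *)
pose S s := 1 - fine (F (expR s)).
have S_noninc : {homo S : s t / s <= t >-> t <= s}.
  move=> s t st; rewrite /S lerD2l lerN2 -hF fine_le ?fin_num_measure//.
  by rewrite cdf_nondecreasing// ler_expR.
have S_prob s : 0 <= S s <= 1.
  rewrite /S -hF subr_ge0 gerBl fine_ge0// andbT.
  by rewrite -lee_fin fineK ?fin_num_measure// probability_le1.
have r0 : 0 < rho^-1 by rewrite invr_gt0.
have rr : rho * rho^-1 = 1 by rewrite mulfV// gt_eqF.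
have mr n : measurable_fun setT (log_max_ratio X_ n).
  exact: measurable_log_max_ratio.
have mle a n : measurable [set w | log_max_ratio X_ n w <= a].
  by rewrite -[X in measurable X]setTI; exact: measurable_fun_le.
have mge a n : measurable [set w | a <= log_max_ratio X_ n w].
  by rewrite -[X in measurable X]setTI; exact: measurable_fun_le.
have mlt (f : T -> R) a : measurable_fun setT f -> measurable [set w | a < f w].
  by move=> mf; rewrite -preimage_itvoy -[X in measurable X]setTI; exact: mf.
have mgt (a : R) n : measurable [set w | a < log_max_ratio X_ n w].
  exact: mlt.
have mdist (e : R) n : measurable [set w | e < `|log_max_ratio X_ n w - rho^-1|].
  by apply: mlt; apply: measurableT_comp => //; exact: measurable_funB.
have fineC n a : fine (P [set w | a < log_max_ratio X_ n w]) =
    1 - fine (P [set w | log_max_ratio X_ n w <= a]).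
  rewrite (_ : [set w | a < _] = ~` [set w | log_max_ratio X_ n w <= a]).
    by rewrite probability_setC// fineB ?fin_num_measure.
  by apply/seteqP; split=> w /=; rewrite ltNge => /negP.
have prob_le (a : R) : 0 < a -> \forall n \near \oo,
    P [set w | log_max_ratio X_ n w <= a] = ((1 - S (a * ln n%:R)) ^+ n)%:E.
  move=> a0; under eq_near do rewrite subKr.
  exact: near_probability_log_max_ratio_le.
have dist_small (e : R) : 0 < e -> \forall n \near \oo,
    fine (P [set w | e < `|log_max_ratio X_ n w - rho^-1|]) <= 2^-1.
  move=> /hcvg /fine_cvgP[_ /cvgrPdist_le h].
  have /h : 0 < 2^-1 :> R by rewrite invr_gt0.
  apply: filterS => n /=.
  by rewrite sub0r normrN => /(le_trans (ler_norm _)).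
have max_large b : 0 < b -> b < rho^-1 ->
    \forall n \near \oo, (1 - S (b * ln n%:R)) ^+ n <= 2^-1.
  (* Half the gap, because the deviation event is strict while {ratio <= b} contains its
     boundary. *)
  move=> b0 br; have e0 : 0 < (rho^-1 - b) / 2 by lra.
  apply: filterS2 (prob_le _ b0) (dist_small _ e0) => n Pb /(le_trans _); apply.
  rewrite -lee_fin -Pb -[X in (X <= _)%E]fineK ?fin_num_measure// lee_fin.
  apply: fine_le_probability => // w /= wb.
  by rewrite ltr_normr; apply/orP; right; lra.
have max_small b : rho^-1 < b ->
    \forall n \near \oo, 2^-1 <= (1 - S (b * ln n%:R)) ^+ n.
  move=> br; have e0 : 0 < b - rho^-1 by lra.
  have b0 : 0 < b by lra.
  apply: filterS2 (prob_le _ b0) (dist_small _ e0) => n Pb Pe.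
  have : fine (P [set w | b < log_max_ratio X_ n w]) <= 2^-1.
    apply: le_trans Pe; apply: fine_le_probability => // w /= wb.
    by rewrite ltr_normr; apply/orP; left; lra.
  by rewrite fineC Pb /=; lra.
split=> [x x0|y y0 yr].
- pose a := rho^-1 + x.
  have ra : rho^-1 < a by rewrite /a; lra.
  have a0 : 0 < a by lra.
  pose f n := fine (P [set w | a <= log_max_ratio X_ n w]).
  have flb : \forall n \near \oo, 1 - (1 - S (a * ln n%:R)) ^+ n <= f n.
    apply: filterS (prob_le _ a0) => n Pa.
    rewrite (_ : _ ^+ n = fine (P [set w | log_max_ratio X_ n w <= a])).
      by rewrite -fineC; apply: fine_le_probability => // w /= /ltW.
    by rewrite Pa.
  have fub a' : 0 < a' -> a' < a ->
      \forall n \near \oo, f n <= 1 - (1 - S (a' * ln n%:R)) ^+ n.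
    move=> a'0 a'a; apply: filterS (prob_le _ a'0) => n Pa.
    rewrite (_ : _ ^+ n = fine (P [set w | log_max_ratio X_ n w <= a'])).
      by rewrite -fineC; apply: fine_le_probability => // w /= /(lt_le_trans a'a).
    by rewrite Pa.
  (* Positivity keeps [lne] finite. Any exponent below 1 - rho a = - rho x gives a positive lower
     bound; here it is lowered by 1. *)
  have f_gt0 : \forall n \near \oo, 0 < f n.
    have u0 : - (rho * x) - 1 < 1 - rho * a by rewrite /a mulrDr rr; lra.
    have := max_gt_ge S_noninc S_prob hrho max_large max_small _ _ ra u0.
    apply: filterS2 flb => n h1 h2.
    have := expR_gt0 ((- (rho * x) - 1) * ln n%:R); lra.
  have -> : - (rho * x) = 1 - rho * a by rewrite /a mulrDr rr; lra.
  have lnf := ln_max_gt_cvg S_noninc S_prob hrho max_large max_small f a ra fub flb.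
  apply: near_EFin_cvg lnf; near=> n.
  rewrite -lne_div_ln//; last 2 first.
  + by near: n.
  + by near: n; exact: nbhs_infty_gt.
  by rewrite /f fineK// fin_num_measure.
- pose a := rho^-1 - y.
  have a0 : 0 < a by rewrite subr_gt0.
  have ar : a < rho^-1 by rewrite /a; lra.
  have lnm := ln_ln_max_le_cvg S_noninc S_prob hrho max_large max_small a a0 ar.
  have := ln_max_le_cvg_pinfty S_noninc S_prob hrho max_large max_small a a0 ar.
  (* Once - ln P is at least e, the maximum inside [eloge] is - ln P itself. *)
  move=> /cvgryPge /(_ (expR 1)) me.
  have -> : rho * y = 1 - rho * a by rewrite /a mulrBr rr; lra.
  have pgt0 := near_max_le_gt0 S_noninc S_prob hrho max_small a a0.
  apply: near_EFin_cvg lnm; near=> n.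
  have en : expR 1 <= - ln ((1 - S (a * ln n%:R)) ^+ n) by near: n.
  have p0 : 0 < (1 - S (a * ln n%:R)) ^+ n by near: n.
  have -> : P [set w | log_max_ratio X_ n w <= a] =
    ((1 - S (a * ln n%:R)) ^+ n)%:E by near: n; exact: prob_le.
  rewrite lne_EFin// /eloge -EFinN -EFin_max max_r// lne_div_ln//.
    by rewrite (lt_le_trans _ en)// expR_gt0.
  by near: n; exact: nbhs_infty_gt.
Unshelve. all: by end_near. Qed.
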